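(* Let $\gamma\colon\omega\to S$ be a precomplete numbering of a set $S$, and let $A\subseteq\omega$ be a computably enumerable set with $A<_T\emptyset'$ (i.e. $A$ is Turing incomplete). If $g\colon\omega\to\omega$ is a (total) $A$-computable function, then $g$ has a fixed point modulo $\sim_\gamma$, i.e. there exists $n\in\omega$ such that $g(n)\sim_\gamma n$.
   Context: $\omega$ denotes the set of natural numbers and $\emptyset'$ the halting set; $\leq_T$ is Turing reducibility, and $A<_T\emptyset'$ means $A\leq_T\emptyset'$ and $\emptyset'\not\leq_T A$. A numbering of a set $S$ is a surjection $\gamma\colon\omega\to S$. Given $\gamma$, write $n\sim_\gamma m$ if $\gamma(n)=\gamma(m)$. The numbering $\gamma$ is precomplete if for every partial computable unary function $\psi$ there exists a total computable unary function $f$ such that for every $n$: if $\psi(n)$ is defined, then $f(n)\sim_\gamma\psi(n)$. A function is $A$-computable if it is computable by a Turing machine with oracle $A$. *)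

(* Defs.v *)
From mathcomp Require Import all_boot.
From mathcomp Require Import boolp classical_sets.

Set Implicit Arguments.
Unset Strict Implicit.
Unset Printing Implicit Defensive.

Local Open Scope classical_set_scope.
Local Open Scope nat_scope.

(** * Oracle Turing machines *)

(* A machine has a one-way infinite read/write work tape and a one-way infinite
   read-only oracle tape.  States and symbols are natural numbers; since a
   program is a finite table, only finitely many of them occur in it.  The
   initial state is 0 and the blank is 0. *)

Variant direction := Left | Right | Stay.

(* In state [src], reading [wread] on the work tape and [oread] on the oracle
   tape: write [wwrite] on the work tape, move the two heads by [wmove] and
   [omove], and go to state [dst]. *)
Record instr := Instr {
  src : nat; wread : nat; oread : nat;
  dst : nat; wwrite : nat; wmove : direction; omove : direction }.

Definition program := seq instr.

(* Cells of [tape] beyond its size are blank. *)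
Record config := Config {
  state : nat; tape : seq nat; whead : nat; ohd : nat }.

(* Cell 0 of the oracle tape is a blank end marker; cell n.+1 holds 2 if n is
   in A and 1 otherwise. *)
Definition oracle_cell (A : set nat) (i : nat) : nat :=
  if i is n.+1 then (if `[< A n >] then 2 else 1) else 0.

(* A head on the leftmost cell does not move when told to go left. *)
Definition shift (d : direction) (h : nat) : nat :=
  match d with Left => h.-1 | Right => h.+1 | Stay => h end.

Definition applicable (A : set nat) (c : config) (i : instr) : bool :=
  [&& src i == state c, wread i == nth 0 (tape c) (whead c)
    & oread i == oracle_cell A (ohd c)].

Definition apply_instr (c : config) (i : instr) : config :=
  Config (dst i) (set_nth 0 (tape c) (whead c) (wwrite i))
         (shift (wmove i) (whead c)) (shift (omove i) (ohd c)).

(* The first applicable instruction is executed, so that every program is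
   deterministic; the machine halts when no instruction is applicable. *)
Definition step (A : set nat) (M : program) (c : config) : option config :=
  omap (apply_instr c) (ohead [seq i <- M | applicable A c i]).

(* The input n is written in unary. *)
Definition init (n : nat) : config := Config 0 (nseq n 1) 0 0.

Definition run (A : set nat) (M : program) (n t : nat) : option config :=
  iter t (obind (step A M)) (Some (init n)).

(* The output is the number of 1s on the work tape at the halting time. *)
Definition eval (A : set nat) (M : program) (n v : nat) : Prop :=
  exists t c, [/\ run A M n t = Some c, step A M c = None
                & v = count_mem 1 (tape c)].

(** * Computability; [psi n = None] means that psi is undefined at n *)

Definition partial_computable_in (A : set nat) (psi : nat -> option nat) : Prop :=
  exists M : program, forall n v, psi n = Some v <-> eval A M n v.

Definition computable_in (A : set nat) (f : nat -> nat) : Prop :=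
  partial_computable_in A (fun n => Some (f n)).

Definition partial_computable (psi : nat -> option nat) : Prop :=
  partial_computable_in set0 psi.

Definition computable (f : nat -> nat) : Prop := computable_in set0 f.

Definition computably_enumerable (A : set nat) : Prop :=
  exists psi, partial_computable psi /\ forall n, A n <-> exists v, psi n = Some v.

Definition turing_le (A B : set nat) : Prop :=
  computable_in B (fun n => if `[< A n >] then 1 else 0).

Definition turing_lt (A B : set nat) : Prop :=
  turing_le A B /\ ~ turing_le B A.

(** * Goedel numbering of programs and the halting set *)

Definition code_dir (d : direction) : nat :=
  match d with Left => 0 | Right => 1 | Stay => 2 end.

Definition decode_dir (n : nat) : direction :=
  match n with 0 => Left | 1 => Right | _ => Stay end.

Definition code_instr (i : instr) : nat :=
  CodeSeq.code [:: src i; wread i; oread i; dst i; wwrite i;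
                   code_dir (wmove i); code_dir (omove i)].

Definition decode_instr (n : nat) : instr :=
  let s := CodeSeq.decode n in
  Instr (nth 0 s 0) (nth 0 s 1) (nth 0 s 2) (nth 0 s 3) (nth 0 s 4)
        (decode_dir (nth 0 s 5)) (decode_dir (nth 0 s 6)).

Definition code_program (M : program) : nat :=
  CodeSeq.code [seq code_instr i | i <- M].

Definition decode_program (e : nat) : program :=
  [seq decode_instr n | n <- CodeSeq.decode e].

Lemma code_programK : cancel code_program decode_program.
Proof.
move=> M; rewrite /decode_program /code_program CodeSeq.codeK -map_comp.
rewrite -[RHS]map_id; apply: eq_map => -[q a o q' a' d d'] /=.
by rewrite /decode_instr /code_instr CodeSeq.codeK; case: d d' => [] [].
Qed.

Definition halting_set : set nat :=
  [set e | exists v, eval set0 (decode_program e) e v].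

(** * Numberings *)

Definition numbering (S : Type) (gamma : nat -> S) : Prop :=
  forall s, exists n, gamma n = s.

Definition num_equiv (S : Type) (gamma : nat -> S) (n m : nat) : Prop :=
  gamma n = gamma m.

Definition precomplete (S : Type) (gamma : nat -> S) : Prop :=
  forall psi, partial_computable psi ->
  exists f, computable f /\
    forall n v, psi n = Some v -> num_equiv gamma (f n) v.

(* Main.v *)
(** Suppose that [g] has no fixed point, let [A_t] be the stage-[t] approximation
    to [A], and let [psi (e, x)] be the output of the machine of [g], run with
    oracle [A_t] on the input [phi_e (e, x)], where [t] is a stage at which [x]
    is in the halting set and [phi_e (e, x)] has converged.  Precompleteness
    gives a computable [f] that agrees with [psi] modulo [gamma]; let [e] be a
    program for [f] and put [h x = f (e, x)].  With oracle [A] one can find a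
    stage [t] at which [A_t] is correct on the use of the computation of
    [g (h x)], and [A_s] stays correct there for all [s >= t].  If [x] entered
    the halting set after stage [t], then [h x ~ psi (e, x) = g (h x)], a fixed
    point.  So [x] is in the halting set iff it is there by stage [t], and the
    halting set is computable in [A].

    The functions involved are all of the form "primitive recursive in the
    oracle, after one unbounded search".  They are computed by while programs on
    registers, these by counter machines, and these by Turing machines whose
    tape carries one track per register. *)

Require Import Defs.
From mathcomp Require Import all_boot.
From mathcomp Require Import boolp classical_sets.
From mathcomp Require Import zify.

Set Implicit Arguments.
Unset Strict Implicit.
Unset Printing Implicit Defensive.

Local Open Scope nat_scope.

(** * Counter machines on Turing machines *)

Definition env := nat -> nat.

Definition upd (s : env) (i v : nat) : env := fun j => if j == i then v else s j.

Inductive cinstr :=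
  INC of nat | DEC of nat | JZ of nat & nat | JMP of nat | QRY of nat & nat.

Definition cexec (A : set nat) (i : cinstr) (x : nat * env) : nat * env :=
  let: (pc, s) := x in
  match i with
  | INC r => (pc.+1, upd s r (s r).+1)
  | DEC r => (pc.+1, upd s r (s r).-1)
  | JZ r q => (if s r == 0 then q else pc.+1, s)
  | JMP q => (q, s)
  | QRY r q => (if `[< A (s r) >] then pc.+1 else q, s)
  end.

Definition instr_at (P : seq cinstr) (pc : nat) := nth (JMP 0) P pc.

Inductive creach (A : set nat) (P : seq cinstr) : nat * env -> nat * env -> Prop :=
| creach_refl x : creach A P x x
| creach_step x y : x.1 < size P -> creach A P (cexec A (instr_at P x.1) x) y ->
    creach A P x y.

Lemma creach_trans A P x y z : creach A P x y -> creach A P y z -> creach A P x z.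
Proof. by elim=> // {}x {}y lt_x _ IH /IH; apply: creach_step. Qed.

Definition creg (i : cinstr) : nat :=
  match i with INC r => r | DEC r => r | JZ r _ => r | JMP _ => 0 | QRY r _ => r end.

(** A tape symbol is a column of [k] bits, one per track. The blank 0 is the empty column, and 1 is
    a mark on track 0 alone. *)
Fixpoint enc (k : nat) (b : nat -> bool) : nat :=
  if k is k'.+1 then b 0 + (enc k' (fun j => b j.+1)).*2 else 0.

Fixpoint bit (r a : nat) : bool := if r is r'.+1 then bit r' a./2 else odd a.

Fixpoint setb (r : nat) (v : bool) (a : nat) : nat :=
  if r is r'.+1 then odd a + (setb r' v a./2).*2 else v + (a./2).*2.

Lemma bit_enc k b r : r < k -> bit r (enc k b) = b r.
Proof.
elim: k b r => // k IH b [|r] /= rk; first by rewrite oddD odd_double oddb addbF.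
by rewrite half_bit_double IH.
Qed.

Lemma setb_enc k b r v : r < k ->
  setb r v (enc k b) = enc k (fun j => if j == r then v else b j).
Proof.
elim: k b r => // k IH b [|r] /= rk; rewrite half_bit_double //.
by rewrite IH // oddD odd_double oddb addbF.
Qed.

Lemma enc_lt k b : enc k b < 2 ^ k.
Proof.
elim: k b => // k IH b; rewrite /= expnS.
by have := IH (fun j => b j.+1); case: (b 0); lia.
Qed.

Lemma enc0 k b : (forall j, j < k -> b j = false) -> enc k b = 0.
Proof. by elim: k b => // k IH b b0; rewrite /= b0 // IH // => j jk; apply: b0. Qed.

Lemma eq_enc k b b' : (forall j, j < k -> b j = b' j) -> enc k b = enc k b'.
Proof.
elim: k b b' => // k IH b b' e.
by rewrite /= e // (IH _ (fun j => b' j.+1)) // => j jk; apply: e.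
Qed.

(* In state [pc * 4 + ph], phase 0 scans right to the end of the register, phase
   1 returns to the left end and goes to [pc.+1], phase 2 acts at the end of the
   register, and phase 3 returns to the left end and jumps. *)
Definition delta (P : seq cinstr) (q a o : nat) : option instr :=
  let pc := q %/ 4 in
  let go q' a' d := Some (Instr q a o q' a' d d) in
  let ret t := if o == 0 then go (t * 4) a Stay else go q a Left in
  if pc < size P then
    match instr_at P pc, q %% 4 with
    | INC r, 0 => if bit r a then go q a Right else go (pc * 4 + 1) (setb r true a) Stay
    | INC r, _ => ret pc.+1
    | DEC r, 0 => if bit r a then go q a Right else go (pc * 4 + 2) a Left
    | DEC r, 2 => go (pc * 4 + 1) (setb r false a) Stay
    | DEC r, _ => ret pc.+1
    | JZ r t, _ => if bit r a then go (pc.+1 * 4) a Stay else go (t * 4) a Stay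
    | JMP t, _ => go (t * 4) a Stay
    | QRY r t, 0 => if bit r a then go q a Right else go (pc * 4 + 2) a Right
    | QRY r t, 1 => ret pc.+1
    | QRY r t, 2 => go (pc * 4 + (if o == 2 then 1 else 3)) a Stay
    | QRY r t, _ => ret t
    end
  else None.

Definition triples (q k : nat) : seq (nat * nat * nat) :=
  [seq (x, o) | x <- [seq (q', a) | q' <- iota 0 q, a <- iota 0 k], o <- iota 0 3].

Definition tm_of (k : nat) (P : seq cinstr) : program :=
  pmap (fun x => delta P x.1.1 x.1.2 x.2) (triples (size P * 4) (2 ^ k)).

(** Only [x0] can yield an instruction that passes the test, so neither order nor repetitions in [s]
    matter. *)
Lemma ohead_filter_pmap (T : eqType) (U : Type) (f : T -> option U) (a : pred U) s x0 :
  (forall x i, f x = Some i -> a i = (x == x0)) ->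
  ohead [seq i <- pmap f s | a i] = if x0 \in s then f x0 else None.
Proof.
move=> fa; elim: s => //= x s IH; rewrite inE.
case: (eqVneq x0 x) => [<-|ne] /=.
  by case fx: (f x0) => [i|] /=; [rewrite (fa _ _ fx) eqxx|rewrite IH fx if_same].
by case fx: (f x) => [i|] //=; rewrite (fa _ _ fx) eq_sym (negbTE ne).
Qed.

Lemma delta_src P q a o i : delta P q a o = Some i ->
  [/\ src i = q, wread i = a & oread i = o].
Proof.
rewrite /delta; case: ifP => // _.
by case: (instr_at P _) => [r|r|r t|t|r t]; case: (q %% 4) => [|[|[|m]]];
  repeat case: ifP => _; case=> <-.
Qed.

Lemma oracle_cell_lt A i : oracle_cell A i < 3.
Proof. by case: i => //= n; case: ifP. Qed.

Lemma mem_triples q k x : (x \in triples q k) = [&& x.1.1 < q, x.1.2 < k & x.2 < 3].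
Proof.
apply/allpairsP/and3P => [[[[q' a] o]] /= []|[h1 h2 h3]].
  move=> /allpairsP[[q2 a2] [/= h1 h2 [-> ->]]] h3 -> /=.
  by move: h1 h2; rewrite !mem_iota /= => -> ->; case: o h3 => [|[|[]]].
exists x; rewrite mem_iota add0n h3; split=> //; last by case: x {h1 h2 h3} => [[? ?] ?].
by apply/allpairsP; exists x.1; rewrite !mem_iota !add0n h1 h2; split=> //; case: x.1.
Qed.

Lemma step_tm A k P c : nth 0 (tape c) (whead c) < 2 ^ k ->
  step A (tm_of k P) c =
  omap (apply_instr c)
    (delta P (state c) (nth 0 (tape c) (whead c)) (oracle_cell A (ohd c))).
Proof.
move=> ak; rewrite /step /tm_of.
rewrite (@ohead_filter_pmap _ _ _ _ _
  (state c, nth 0 (tape c) (whead c), oracle_cell A (ohd c))) => [|x i /delta_src[e1 e2 e3]].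
  rewrite mem_triples /= ak oracle_cell_lt !andbT; case: ifP => // qP.
  (* A state outside the table has its program counter past the end of [P], where [delta] is [None]
     as well. *)
  by rewrite /delta ltn_divLR // qP.
by rewrite /applicable e1 e2 e3; case: x {e1 e2 e3} => [[x y] z]; rewrite !xpair_eqE -andbA.
Qed.

(** * Runs of the compiled Turing machine *)

Definition treach (A : set nat) (M : program) (c c' : config) : Prop :=
  exists t, iter t (obind (step A M)) (Some c) = Some c'.

Lemma treach_refl A M c : treach A M c c.
Proof. by exists 0. Qed.

Lemma treach_trans A M c1 c2 c3 : treach A M c1 c2 -> treach A M c2 c3 -> treach A M c1 c3.
Proof. by move=> [t e] [u e']; exists (u + t); rewrite iterD e. Qed.

Lemma treach1 A M c c' : step A M c = Some c' -> treach A M c c'.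
Proof. by exists 1. Qed.

(* Register [j] is track [j] of the tape, in unary; the oracle head is kept at
   the position of the work head, so that the end marker of the oracle tape
   also marks the left end of the work tape. *)
Definition represents (k q h : nat) (s : env) (c : config) : Prop :=
  [/\ state c = q, whead c = h, ohd c = h
    & forall p, nth 0 (tape c) p = enc k (fun j => p < s j)].

Definition reaches A k P c q h s := exists2 c', treach A (tm_of k P) c c' & represents k q h s c'.

Lemma reaches_trans A k P c q h s q' h' s' :
  reaches A k P c q h s ->
  (forall c', represents k q h s c' -> reaches A k P c' q' h' s') ->
  reaches A k P c q' h' s'.
Proof.
by move=> [c' cc' /[swap] /[apply] -[c'' c'c'' r]]; exists c'' => //; apply: treach_trans c'c''.
Qed.

(** Both heads move by the same [d], so they stay aligned; the tape changes at most in the scanned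
    column. *)
Lemma reaches1 A k P q h s c q' a' d s' :
  represents k q h s c ->
  delta P q (enc k (fun j => h < s j)) (oracle_cell A h) =
    Some (Instr q (enc k (fun j => h < s j)) (oracle_cell A h) q' a' d d) ->
  (forall p, enc k (fun j => p < s' j) = if p == h then a' else enc k (fun j => p < s j)) ->
  reaches A k P c q' (shift d h) s'.
Proof.
move=> [eq eh eo et] de es.
exists (apply_instr c (Instr q (enc k (fun j => h < s j)) (oracle_cell A h) q' a' d d)).
  by apply: treach1; rewrite step_tm ?eq ?eh ?eo ?et ?enc_lt // de.
by split=> //=; rewrite ?eh ?eo // => p; rewrite nth_set_nth /= es et.
Qed.

Lemma reaches_move A k P q h s c q' d :
  represents k q h s c ->
  delta P q (enc k (fun j => h < s j)) (oracle_cell A h) =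
    Some (Instr q (enc k (fun j => h < s j)) (oracle_cell A h) q' (enc k (fun j => h < s j)) d d) ->
  reaches A k P c q' (shift d h) s.
Proof. by move=> r de; apply: reaches1 r de _ => p; case: eqP => // ->. Qed.

Lemma reaches_scan A k P q r h s c : r < k -> h <= s r ->
  (forall a o, bit r a -> delta P q a o = Some (Instr q a o q a Right Right)) ->
  represents k q h s c -> reaches A k P c q (s r) s.
Proof.
move=> rk hs de; move: {2}(s r - h) (erefl (s r - h)) => n.
elim: n h c hs => [|n IH] h c hs en rep.
  by exists c; [apply: treach_refl|have -> : s r = h by lia].
apply: (reaches_trans (q := q) (h := h.+1) (s := s)).
  by apply: (reaches_move (d := Right) rep); apply: de; rewrite bit_enc //; lia.
by move=> c' rep'; apply: IH rep'; lia.
Qed.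

(** The oracle symbol 0 occurs only in cell 0, which is how the left end is recognised. *)
Lemma reaches_return A k P q q' h s c :
  (forall a o, delta P q a o = if o == 0 then Some (Instr q a o q' a Stay Stay)
     else Some (Instr q a o q a Left Left)) ->
  represents k q h s c -> reaches A k P c q' 0 s.
Proof.
move=> de; elim: h c => [|h IH] c rep; first by apply: (reaches_move (d := Stay) rep); rewrite de.
apply: (reaches_trans (q := q) (h := h) (s := s)) => //.
by apply: (reaches_move (d := Left) rep); rewrite de /=; case: asbool.
Qed.

Lemma reaches_cexec A k P pc s c : all (fun i => creg i < k) P -> pc < size P ->
  represents k (pc * 4) 0 s c ->
  let x := cexec A (instr_at P pc) (pc, s) in reaches A k P c (x.1 * 4) 0 x.2.
Proof.
move=> /all_nthP-/(_ (JMP 0) pc) rP ltP; have {}rP := rP ltP.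
have phE m : m < 4 -> ((pc * 4 + m) %/ 4 = pc) * ((pc * 4 + m) %% 4 = m).
  by move=> m4; rewrite divnMDl // divn_small // addn0 modnMDl modn_small.
have ph0 : ((pc * 4) %/ 4 = pc) * ((pc * 4) %% 4 = 0) by rewrite mulnK // modnMl.
rewrite /= /instr_at in rP *; move eI: (nth _ P pc) rP => [r|r|r t|t|r t] /= rk rep.
- apply: reaches_trans (reaches_scan A rk _ _ rep) _ => // [a o ba|{rep}c rep].
    by rewrite /delta !ph0 ltP /instr_at eI ba.
  apply: (reaches_trans (q := pc * 4 + 1) (h := s r) (s := upd s r (s r).+1)).
    apply: (reaches1 (d := Stay) rep).
      by rewrite /delta !ph0 ltP /instr_at eI bit_enc // ltnn.
    move=> p; rewrite setb_enc //; case: eqP => [->|/eqP np]; apply: eq_enc => j _;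
      rewrite /upd; case: eqP => [?|_]; try subst j; lia.
  move=> c'; apply: reaches_return => a o.
  by rewrite /delta !phE // ltP /instr_at eI.
- apply: reaches_trans (reaches_scan A rk _ _ rep) _ => // [a o ba|{rep}c rep].
    by rewrite /delta !ph0 ltP /instr_at eI ba.
  (* If [s r] is 0, the move left has no effect and clearing the bit in cell 0 changes nothing, in
     agreement with [0.-1 = 0]. *)
  apply: (reaches_trans (q := pc * 4 + 2) (h := (s r).-1) (s := s)).
    by apply: (reaches_move (d := Left) rep); rewrite /delta !ph0 ltP /instr_at eI bit_enc // ltnn.
  move=> {rep}c rep.
  apply: (reaches_trans (q := pc * 4 + 1) (h := (s r).-1) (s := upd s r (s r).-1)).
    apply: (reaches1 (d := Stay) rep).
      by rewrite /delta !phE // ltP /instr_at eI.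
    move=> p; rewrite setb_enc //; case: eqP => [->|/eqP np]; apply: eq_enc => j _;
      rewrite /upd; case: eqP => [?|_]; try subst j; lia.
  move=> c'; apply: reaches_return => a o.
  by rewrite /delta !phE // ltP /instr_at eI.
- apply: (reaches_move (d := Stay) rep).
  rewrite /delta !ph0 ltP /instr_at eI bit_enc // lt0n.
  by case: eqP.
- by apply: (reaches_move (d := Stay) rep); rewrite /delta !ph0 ltP /instr_at eI.
- apply: reaches_trans (reaches_scan A rk _ _ rep) _ => // [a o ba|{rep}c rep].
    by rewrite /delta !ph0 ltP /instr_at eI ba.
  (* Membership of [s r] in [A] is recorded in oracle cell [(s r).+1], one past the scanned end of
     the register. *)
  apply: (reaches_trans (q := pc * 4 + 2) (h := (s r).+1) (s := s)).
    by apply: (reaches_move (d := Right) rep); rewrite /delta !ph0 ltP /instr_at eI bit_enc // ltnn.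
  move=> {rep}c rep.
  apply: (reaches_trans (q := pc * 4 + if `[< A (s r) >] then 1 else 3) (h := (s r).+1) (s := s)).
    apply: (reaches_move (d := Stay) rep).
    by rewrite /delta !phE // ltP /instr_at eI /=; case: asbool.
  move=> c'; apply: reaches_return => a o.
  by case: asbool; rewrite /delta !phE // ltP /instr_at eI.
Qed.

Lemma reaches_creach A k P x y : all (fun i => creg i < k) P -> creach A P x y ->
  forall c, represents k (x.1 * 4) 0 x.2 c -> reaches A k P c (y.1 * 4) 0 y.2.
Proof.
move=> rP; elim=> {x y} [x c rep|[pc s] y /= ltP _ IH c rep].
  by exists c => //; apply: treach_refl.
by apply: reaches_trans IH; apply: reaches_cexec.
Qed.

Lemma count_unary (s : seq nat) v : (forall p, nth 0 s p = (p < v)) -> count_mem 1 s = v.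
Proof.
elim: s v => [|a s IH] v es; first by case: v es => // v /(_ 0).
have := es 0; rewrite /= => ->; case: v es => [|v] es /=.
  by apply: IH => p; apply: (es p.+1).
by rewrite (IH v) // => p; apply: (es p.+1).
Qed.

(** The output counts the symbol 1, which is the column marked on track 0 only; hence all other
    registers must be empty at the end. *)
Lemma eval_tm A k P n s : 0 < k -> all (fun i => creg i < k) P ->
  creach A P (0, upd (fun=> 0) 0 n) (size P, s) -> (forall j, 0 < j < k -> s j = 0) ->
  eval A (tm_of k P) n (s 0).
Proof.
move=> k0 rP cr s0.
have enc1 (s' : env) : (forall j, 0 < j < k -> s' j = 0) -> forall p,
    enc k (fun j => p < s' j) = (p < s' 0).
  case: k k0 s0 {rP} => // k _ _ s0' p /=; rewrite enc0 ?addn0 // => j jk.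
  by rewrite s0'.
have [|c' [t et] [eq eh eo etp]] := reaches_creach rP cr (c := init n).
  split=> // p; rewrite enc1 /=; last by case.
  by rewrite /upd eqxx nth_nseq; case: ltnP.
exists t, c'; split=> //.
  by rewrite step_tm ?etp ?enc_lt // eq /delta /= mulnK // ltnn.
by apply/esym/count_unary => p; rewrite etp enc1.
Qed.

(** * While programs *)

Inductive cmd :=
  Inc of nat | Dec of nat | Ask of nat & nat | Seq of cmd & cmd | While of nat & cmd.

Inductive exec (A : set nat) : cmd -> env -> env -> Prop :=
| exec_inc r s : exec A (Inc r) s (upd s r (s r).+1)
| exec_dec r s : exec A (Dec r) s (upd s r (s r).-1)
| exec_ask r t s : exec A (Ask r t) s (if `[< A (s r) >] then upd s t (s t).+1 else s)
| exec_seq c1 c2 s1 s2 s3 : exec A c1 s1 s2 -> exec A c2 s2 s3 -> exec A (Seq c1 c2) s1 s3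
| exec_while0 r c s : s r = 0 -> exec A (While r c) s s
| exec_whileS r c s1 s2 s3 : s1 r != 0 -> exec A c s1 s2 -> exec A (While r c) s2 s3 ->
    exec A (While r c) s1 s3.

Fixpoint len (c : cmd) : nat :=
  match c with
  | Inc _ | Dec _ => 1
  | Ask _ _ => 2
  | Seq c1 c2 => len c1 + len c2
  | While _ c => (len c).+2
  end.

(** Jump targets are absolute, so [b] records the address at which the code is placed. *)
Fixpoint compile (b : nat) (c : cmd) : seq cinstr :=
  match c with
  | Inc r => [:: INC r]
  | Dec r => [:: DEC r]
  | Ask r t => [:: QRY r b.+2; INC t]
  | Seq c1 c2 => compile b c1 ++ compile (b + len c1) c2
  | While r c => JZ r (b + (len c).+2) :: rcons (compile b.+1 c) (JMP b)
  end.

Fixpoint regs (c : cmd) : nat :=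
  match c with
  | Inc r | Dec r => r.+1
  | Ask r t => maxn r.+1 t.+1
  | Seq c1 c2 => maxn (regs c1) (regs c2)
  | While r c => maxn r.+1 (regs c)
  end.

Lemma size_compile b c : size (compile b c) = len c.
Proof.
elim: c b => //= [c1 IH1 c2 IH2|r c IH] b; first by rewrite size_cat IH1 IH2.
by rewrite size_rcons IH.
Qed.

Lemma regs_gt0 c : 0 < regs c.
Proof. by elim: c => //= *; rewrite leq_max //; apply/orP; left. Qed.

Lemma creg_compile k b c : regs c <= k -> all (fun i => creg i < k) (compile b c).
Proof.
move=> ck; have k0 := leq_trans (regs_gt0 c) ck.
elim: c b ck => /= [r|r|r t|c1 IH1 c2 IH2|r c IH] b; rewrite ?geq_max.
- by rewrite andbT.
- by rewrite andbT.
- by move=> /andP[-> ->].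
- by move=> /andP[h1 h2]; rewrite all_cat IH1 ?IH2.
- by move=> /andP[-> h]; rewrite all_rcons /= k0 IH.
Qed.

Lemma creach_at A P P1 i P2 b s y : P = P1 ++ i :: P2 -> size P1 = b ->
  creach A P (cexec A i (b, s)) y -> creach A P (b, s) y.
Proof.
move=> -> <- h; apply: creach_step; first by rewrite /= size_cat /= -addSnnS leq_addr.
by rewrite /= /instr_at nth_cat ltnn subnn.
Qed.

(** The code may stand anywhere in a larger program; the induction on the execution needs this
    generality. *)
Lemma creach_compile A c s s' : exec A c s s' -> forall P P1 P2 b,
  P = P1 ++ compile b c ++ P2 -> size P1 = b -> creach A P (b, s) (b + len c, s').
Proof.
elim=> {c s s'} [r s|r s|r t s|c1 c2 s1 s2 s3 _ IH1 _ IH2|r c s s0|r c s1 s2 s3 s1r _ IH1 _ IH2]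
  P P1 P2 b /= eP eb.
- by apply: (creach_at eP eb); rewrite /= addn1; apply: creach_refl.
- by apply: (creach_at eP eb); rewrite /= addn1; apply: creach_refl.
- apply: (creach_at eP eb); rewrite /= addn2; case: asboolP => _; last exact: creach_refl.
  move: eP; rewrite -cat_rcons => eP; apply: (creach_at eP); last exact: creach_refl.
  by rewrite size_rcons eb.
- rewrite -catA in eP; apply: creach_trans (IH1 _ _ _ _ eP eb) _.
  by rewrite addnA; apply: (IH2 _ (P1 ++ compile b c1) P2);
    [rewrite eP catA|rewrite size_cat size_compile eb].
- by apply: (creach_at eP eb); rewrite /= s0; apply: creach_refl.
- apply: creach_trans (IH2 _ _ _ _ eP eb); apply: (creach_at eP eb); rewrite /= (negbTE s1r).
  rewrite -cats1 -catA -cat_rcons in eP.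
  apply: creach_trans (IH1 _ _ _ _ eP _) _; first by rewrite size_rcons eb.
  rewrite catA /= in eP; apply: (creach_at eP); last exact: creach_refl.
  by rewrite size_cat size_compile size_rcons eb.
Qed.

Lemma upd_id s i v : s i = v -> upd s i v = s.
Proof. by move=> e; apply/funext => j; rewrite /upd; case: eqP => // ->. Qed.

Lemma upd_upd s i v w : upd (upd s i v) i w = upd s i w.
Proof. by apply/funext => j; rewrite /upd; case: eqP. Qed.

(** Total correctness of a loop: in the invariant [I m], the number [m] counts the remaining
    rounds. *)
Lemma exec_while A r c (I : nat -> env -> Prop) :
  (forall m s, I m.+1 s -> s r != 0 /\ exists2 s', exec A c s s' & I m s') ->
  (forall s, I 0 s -> s r = 0) ->
  forall m s, I m s -> exists2 s', exec A (While r c) s s' & I 0 s'.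
Proof.
move=> IS I0; elim=> [|m IH] s Is; first by exists s => //; apply/exec_while0/I0.
have [sr [s1 e1 /IH[s2 e2 I2]]] := IS _ _ Is.
by exists s2 => //; apply: exec_whileS e1 e2.
Qed.

Ltac upd_cases := rewrite /upd;
  repeat match goal with |- context [if ?a == ?b then _ else _] =>
    case: (@eqP _ a b) => ? end;
  subst; try lia.

Definition zero r := While r (Dec r).

Lemma exec_zero A r s : exec A (zero r) s (upd s r 0).
Proof.
have [|||s' e <-] := @exec_while A r (Dec r) (fun m t => t = upd s r m) _ _ (s r) s.
- by move=> m t ->; rewrite /upd eqxx; split=> //; eexists; [constructor|rewrite upd_upd eqxx].
- by move=> t ->; rewrite /upd eqxx.
- by rewrite upd_id.
by [].
Qed.

(** Reading a register empties it, so [i] is poured into both [j] and [t] and then refilled from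
    [t]. *)
Definition copy i j t := Seq (zero j) (Seq (zero t)
  (Seq (While i (Seq (Dec i) (Seq (Inc j) (Inc t)))) (While t (Seq (Dec t) (Inc i))))).

Lemma exec_copy A i j t s : i != j -> i != t -> j != t ->
  exec A (copy i j t) s (upd (upd s j (s i)) t 0).
Proof.
move=> /eqP ij /eqP it /eqP jt.
pose s0 := upd (upd s j 0) t 0.
have [] := @exec_while A i (Seq (Dec i) (Seq (Inc j) (Inc t))) (fun m s' =>
    m <= s i /\ s' = upd (upd (upd s i m) j (s i - m)) t (s i - m)) _ _ (s i) s0.
- move=> m s' [le_m ->]; split; first by upd_cases.
  eexists; first by do !econstructor.
  split; first by lia.
  by apply/funext => k; upd_cases.
- by move=> s' [_ ->]; upd_cases.
- split=> //; rewrite subnn /s0; apply/funext => k; upd_cases.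
move=> s1 e1 [_ es1].
have [] := @exec_while A t (Seq (Dec t) (Inc i)) (fun m s' =>
    m <= s i /\ s' = upd (upd (upd s i (s i - m)) j (s i)) t m) _ _ (s i) s1.
- move=> m s' [le_m ->]; split; first by upd_cases.
  eexists; first by do !econstructor.
  split; first by lia.
  by apply/funext => k; upd_cases.
- by move=> s' [_ ->]; upd_cases.
- by split=> //; rewrite es1 subn0 subnn.
move=> s2 e2 [_ es2].
apply: exec_seq (exec_zero _ _ _) _; apply: exec_seq (exec_zero _ _ _) _.
apply: exec_seq e1 _; suff <- : s2 = upd (upd s j (s i)) t 0 by [].
by rewrite es2 subn0 (upd_id (s := s)).
Qed.

(** Variables are de Bruijn indices, and [scons] binds a new variable 0. *)
Definition scons (n : nat) (e : env) : env := fun i => if i is i'.+1 then e i' else n.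

(* In a state [s] the variables of [F] are read off the registers [rho i]; all
   registers from [N] on are free, and the value goes to register [N]. *)
Definition Cp (A : set nat) (F : env -> nat) : Prop :=
  forall (rho : env) N, (forall i, rho i < N) -> exists c, forall s, exists s',
    [/\ exec A c s s', forall i, i < N -> s' i = s i & s' N = F (fun i => s (rho i))].

Lemma scons_lt (rho : env) n N : (forall i, rho i < N) -> n < N.+1 ->
  forall i, scons n rho i < N.+1.
Proof. by move=> rN nN [|i] //=; apply: leq_trans (rN i) _. Qed.

Lemma Cp_ext A F G : (forall e, F e = G e) -> Cp A F -> Cp A G.
Proof. by move=> /funext ->. Qed.

Lemma Cp_ren A (r : env) F : Cp A F -> Cp A (fun e => F (fun i => e (r i))).
Proof. by move=> cF rho N rN; apply: (cF (fun i => rho (r i)) N). Qed.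

Lemma Cp_var A i : Cp A (fun e => e i).
Proof.
move=> rho N rN; exists (copy (rho i) N N.+1) => s; have := rN i => lt_i.
eexists; split; [by apply: exec_copy; lia| |by rewrite /upd eqxx; case: eqP => //; lia].
by move=> k lt_k; rewrite /upd; do !(case: eqP => // ?); lia.
Qed.

Lemma Cp_zero A : Cp A (fun=> 0).
Proof.
move=> rho N rN; exists (zero N) => s; eexists; split; [exact: exec_zero| |by rewrite /upd eqxx].
by move=> k lt_k; rewrite /upd; case: eqP => // ?; lia.
Qed.

Lemma Cp_succ A F : Cp A F -> Cp A (fun e => (F e).+1).
Proof.
move=> cF rho N rN; have [c cE] := cF rho N rN; exists (Seq c (Inc N)) => s.
have [s' [e1 e2 e3]] := cE s; eexists; split; first by apply: exec_seq e1 _; constructor.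
  by move=> k lt_k; rewrite /upd -e2 //; case: eqP => // ?; lia.
by rewrite /upd eqxx e3.
Qed.

Lemma Cp_pred A F : Cp A F -> Cp A (fun e => (F e).-1).
Proof.
move=> cF rho N rN; have [c cE] := cF rho N rN; exists (Seq c (Dec N)) => s.
have [s' [e1 e2 e3]] := cE s; eexists; split; first by apply: exec_seq e1 _; constructor.
  by move=> k lt_k; rewrite /upd -e2 //; case: eqP => // ?; lia.
by rewrite /upd eqxx e3.
Qed.

Lemma Cp_const A n : Cp A (fun=> n).
Proof. by elim: n => [|n IH]; [apply: Cp_zero|apply: Cp_succ]. Qed.

Lemma Cp_ask A F : Cp A F -> Cp A (fun e => `[< A (F e) >]).
Proof.
move=> cF rho N rN; have [c cE] := cF rho N rN.
exists (Seq c (Seq (zero N.+1) (Seq (Ask N N.+1) (copy N.+1 N N.+2)))) => s.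
have [s' [e1 e2 e3]] := cE s; eexists; split.
- apply: exec_seq e1 (exec_seq (exec_zero _ _ _)
    (exec_seq (exec_ask _ _ _ _) (exec_copy _ _ _ _ _))); lia.
- by move=> k lt_k; rewrite /upd -e2 //; case: asbool; do !(case: eqP => // ?); lia.
- have -> : upd s' N.+1 0 N = s' N by upd_cases.
  by rewrite -e3; case: asbool; upd_cases.
Qed.

(** The value of [G] is left in register [N], which becomes variable 0 of [F]; the code of [F] works
    from [N.+1] on. *)
Lemma Cp_let A G F : Cp A G -> Cp A F -> Cp A (fun e => F (scons (G e) e)).
Proof.
move=> cG cF rho N rN; have [c cE] := cG rho N rN.
have [d dE] := cF (scons N rho) N.+1 (scons_lt rN (ltnSn N)).
exists (Seq c (Seq d (copy N.+1 N N.+2))) => s.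
have [s1 [e1 e2 e3]] := cE s; have [s2 [f1 f2 f3]] := dE s1.
exists (upd (upd s2 N (s2 N.+1)) N.+2 0); split.
- by apply: exec_seq e1 (exec_seq f1 (exec_copy _ _ _ _ _)); lia.
- by move=> k lt_k; rewrite -(e2 _ lt_k) -(f2 _ (leqW lt_k)); upd_cases.
- have -> : upd (upd s2 N (s2 N.+1)) N.+2 0 N = s2 N.+1 by upd_cases.
  rewrite f3; congr F; apply/funext => -[|i] //=.
  exact: e2.
Qed.

(** Register [N] counts the remaining rounds, [N.+1] holds the current value and is variable 0 of
    the body, and the body writes to [N.+2]. *)
Lemma Cp_iter A K I B : Cp A K -> Cp A I ->
  Cp A (fun e => B (fun i => e i.+1) (e 0)) -> Cp A (fun e => iter (K e) (B e) (I e)).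
Proof.
move=> cK cI cB rho N rN; have [k kE] := cK rho N rN.
have rN' i : rho i < N.+1 by apply: leqW; apply: rN.
have [d dE] := cI rho N.+1 rN'.
have [b bE] := cB (scons N.+1 rho) N.+2 (scons_lt rN' (ltnSn N.+1)).
exists (Seq k (Seq d (Seq (While N (Seq (Dec N) (Seq b (copy N.+2 N.+1 N.+3))))
  (copy N.+1 N N.+2)))) => s.
have [s1 [e1 e2 e3]] := kE s; have [s2 [f1 f2 f3]] := dE s1.
pose e i := s (rho i).
have [] := @exec_while A N (Seq (Dec N) (Seq b (copy N.+2 N.+1 N.+3))) (fun m s' =>
    [/\ s' N = m, forall i, i < N -> s' i = s i & m <= K e /\ s' N.+1 = iter (K e - m) (B e) (I e)])
    _ _ (K e) s2.
- move=> m t [tN ts [mK tv]]; split; first by rewrite tN.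
  have [t' [g1 g2 g3]] := bE (upd t N (t N).-1).
  exists (upd (upd t' N.+1 (t' N.+2)) N.+3 0).
    by apply: exec_seq (exec_dec _ _ _) (exec_seq g1 (exec_copy _ _ _ _ _)); lia.
  split.
  + have -> : upd (upd t' N.+1 (t' N.+2)) N.+3 0 N = t' N by upd_cases.
    by rewrite (g2 N (leqW (ltnSn N))) tN /upd eqxx.
  + move=> i lt_i.
    have -> : upd (upd t' N.+1 (t' N.+2)) N.+3 0 i = t' i by upd_cases.
    by rewrite (g2 i (leqW (leqW lt_i))) -(ts _ lt_i); upd_cases.
  + split; first exact: ltnW.
    have -> : upd (upd t' N.+1 (t' N.+2)) N.+3 0 N.+1 = t' N.+2 by upd_cases.
    have -> : K e - m = (K e - m.+1).+1 by rewrite -subSn // subSS.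
    rewrite g3 iterS -tv /=; congr (B _ _).
      apply/funext => i; rewrite /= /e -(ts _ (rN i)).
      by have := rN i; move: (rho i) => j lt_j; upd_cases.
    by upd_cases.
- by move=> t [].
- split.
  + by rewrite (f2 N (ltnSn N)) e3.
  + by move=> i lt_i; rewrite (f2 i (leqW lt_i)) e2.
  + split=> //; rewrite subnn f3 /=; congr I; apply/funext => i; exact: e2.
move=> s3 g1 [g2 g3 [_ g4]]; exists (upd (upd s3 N (s3 N.+1)) N.+2 0); split.
- by apply: exec_seq e1 (exec_seq f1 (exec_seq g1 (exec_copy _ _ _ _ _))); lia.
- by move=> i lt_i; rewrite -(g3 _ lt_i); upd_cases.
- have -> : upd (upd s3 N (s3 N.+1)) N.+2 0 N = s3 N.+1 by upd_cases.
  by rewrite g4 subn0.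
Qed.

(** Prepares the final state that [eval_tm] requires. Since [cmd] has no empty command, the base
    case clears register 1. *)
Fixpoint cleanup k := if k is k'.+1 then Seq (zero k) (cleanup k') else zero 1.

Lemma exec_cleanup A k s : exists2 s', exec A (cleanup k) s s' &
  s' 0 = s 0 /\ forall j, s' j = if 0 < j <= maxn k 1 then 0 else s j.
Proof.
elim: k s => [|k IH] s /=.
  by eexists; [exact: exec_zero|split=> // -[|[|j]]].
have [s' e [e0 ej]] := IH (upd s k.+1 0).
exists s'; first by apply: exec_seq (exec_zero _ _ _) e.
split; first by rewrite e0.
move=> j; rewrite ej /upd; case: (eqVneq j k.+1) => [->|ne]; first by rewrite if_same leq_maxl.
by have -> : (0 < j <= maxn k.+1 1) = (0 < j <= maxn k 1) by lia.
Qed.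

Lemma regs_cleanup k : regs (cleanup k) <= (maxn k 1).+1.
Proof. by elim: k => //= k IH; lia. Qed.

(** Unbounded search: register 0 keeps the input, register 1 the candidate, and register 2 the
    negated test that drives the loop. *)
Lemma eval_search A (Q : nat -> nat -> bool) (U : nat -> nat -> nat) :
  Cp A (fun e => Q (e 0) (e 1)) -> Cp A (fun e => U (e 0) (e 1)) ->
  exists M, forall n t, Q n t -> (forall u, u < t -> ~~ Q n u) -> eval A M n (U n t).
Proof.
move=> cQ cU; pose rho := fun i => i != 0 : nat.
have rho2 i : rho i < 2 by rewrite /rho; case: eqP.
(* A loop runs while its register is nonzero, so it needs the negation of [Q]: 1 is replaced by 0
   exactly when [Q] holds. *)
have cQ' : Cp A (fun e => iter (Q (e 0) (e 1)) (fun=> 0) 1).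
  by apply: (Cp_iter (B := fun _ _ => 0)); [exact: cQ|exact: Cp_const|exact: Cp_zero].
have [q qE] := cQ' rho 2 rho2; have [u uE] := cU rho 2 rho2.
pose p := Seq q (Seq (While 2 (Seq (Inc 1) q)) (Seq u (copy 2 0 3))).
pose k := (regs p).+1; pose p' := Seq p (cleanup k).
exists (tm_of k.+1 (compile 0 p')) => n t Qt ltQ.
have [s1 [e1 e2 e3]] := qE (upd (fun=> 0) 0 n).
have [] := @exec_while A 2 (Seq (Inc 1) q) (fun m s' =>
   [/\ m <= t, s' 0 = n, s' 1 = t - m & s' 2 = ~~ Q n (t - m)]) _ _ t s1.
- move=> m s [lt_m sn st sQ]; split; first by rewrite sQ; rewrite ltQ //; lia.
  have [s' [f1 f2 f3]] := qE (upd s 1 (s 1).+1).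
  eexists; first by apply: exec_seq (exec_inc _ _ _) f1.
  split; [exact: ltnW|by rewrite f2|by rewrite f2 // /upd eqxx st; lia|].
  rewrite f3 /rho /upd /= sn st -subSn // subSS.
  by case: (Q _ _).
- by move=> s [_ _ _ ->]; rewrite subn0 Qt.
- split=> //; [by rewrite e2|by rewrite subnn e2|rewrite subnn e3 /rho /upd /=].
  by case: (Q n 0).
move=> s2 f1 [_ f2 f3 _]; have [s3 [g1 g2 g3]] := uE s2.
have [s5 h1 [h2 h3]] := exec_cleanup A k (upd (upd s3 0 (s3 2)) 3 0).
have <- : s5 0 = U n t by rewrite h2 /upd /= g3 /rho /= f2 f3 subn0.
have ep : exec A p' (upd (fun=> 0) 0 n) s5.
  apply: exec_seq h1; apply: exec_seq e1 (exec_seq f1 (exec_seq g1 _)).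
  exact: exec_copy.
apply: eval_tm => //.
- apply: creg_compile; have := regs_cleanup k; have : k = (regs p).+1 by [].
  change (regs p') with (maxn (regs p) (regs (cleanup k))); lia.
- rewrite size_compile -[len p']add0n.
  by apply: (creach_compile ep (P1 := [::]) (P2 := [::])) => //; rewrite cats0.
- by move=> j; rewrite h3 => /andP[j0 jk]; rewrite j0 leq_max -ltnS jk.
Qed.

(** * Primitive recursion *)

Lemma Cp_add A F G : Cp A F -> Cp A G -> Cp A (fun e => F e + G e).
Proof.
move=> cF cG; apply: (@Cp_ext _ (fun e => iter (F e) succn (G e))).
  by move=> e; rewrite iter_succn addnC.
by apply: (Cp_iter (B := fun=> succn)) => //; apply: Cp_succ; apply: Cp_var.
Qed.

Lemma Cp_sub A F G : Cp A F -> Cp A G -> Cp A (fun e => F e - G e).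
Proof.
move=> cF cG; apply: (@Cp_ext _ (fun e => iter (G e) predn (F e))).
  by move=> e; rewrite iter_predn.
by apply: (Cp_iter (B := fun=> predn)) => //; apply: Cp_pred; apply: Cp_var.
Qed.

Lemma Cp_mul A F G : Cp A F -> Cp A G -> Cp A (fun e => F e * G e).
Proof.
move=> cF cG; apply: (@Cp_ext _ (fun e => iter (G e) (addn (F e)) 0)).
  by move=> e; rewrite iter_addn_0.
apply: (Cp_iter (B := fun e => addn (F e))) => //; first exact: Cp_zero.
by apply: Cp_add; [apply: (Cp_ren succn)|apply: Cp_var].
Qed.

Lemma Cp_exp A F G : Cp A F -> Cp A G -> Cp A (fun e => F e ^ G e).
Proof.
move=> cF cG; apply: (@Cp_ext _ (fun e => iter (G e) (muln (F e)) 1)).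
  by move=> e; rewrite iter_muln_1.
apply: (Cp_iter (B := fun e => muln (F e))) => //; first exact: Cp_const.
by apply: Cp_mul; [apply: (Cp_ren succn)|apply: Cp_var].
Qed.

(** A truth value is 0 or 1, so a conditional is an iteration of at most one round that starts at
    [G] and overwrites it with [F]. *)
Lemma Cp_if A (P : env -> bool) F G : Cp A (fun e => P e) -> Cp A F -> Cp A G ->
  Cp A (fun e => if P e then F e else G e).
Proof.
move=> cP cF cG; apply: (@Cp_ext _ (fun e => iter (P e) (fun=> F e) (G e))).
  by move=> e; case: (P e).
by apply: (Cp_iter (B := fun e _ => F e)) => //; apply: (Cp_ren succn).
Qed.

Lemma Cp_leq A F G : Cp A F -> Cp A G -> Cp A (fun e => F e <= G e).
Proof.
move=> cF cG; apply: (@Cp_ext _ (fun e => 1 - (F e - G e))).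
  by move=> e; case: leqP; lia.
by apply: Cp_sub; [apply: Cp_const|apply: Cp_sub].
Qed.

Lemma Cp_neg A (P : env -> bool) : Cp A (fun e => P e) -> Cp A (fun e => ~~ P e).
Proof.
move=> cP; apply: (@Cp_ext _ (fun e => 1 - P e)); first by move=> e; case: (P e).
by apply: Cp_sub; [apply: Cp_const|].
Qed.

Lemma Cp_and A (P Q : env -> bool) : Cp A (fun e => P e) -> Cp A (fun e => Q e) ->
  Cp A (fun e => P e && Q e).
Proof.
move=> cP cQ; apply: (@Cp_ext _ (fun e => P e * Q e)); first by move=> e; rewrite mulnb.
exact: Cp_mul.
Qed.

Lemma Cp_or A (P Q : env -> bool) : Cp A (fun e => P e) -> Cp A (fun e => Q e) ->
  Cp A (fun e => P e || Q e).
Proof.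
move=> cP cQ; apply: (@Cp_ext _ (fun e => ~~ (~~ P e && ~~ Q e))).
  by move=> e; rewrite negb_and !negbK.
by apply/Cp_neg/Cp_and; apply: Cp_neg.
Qed.

Lemma Cp_eq A F G : Cp A F -> Cp A G -> Cp A (fun e => F e == G e).
Proof.
move=> cF cG; apply: (@Cp_ext _ (fun e => (F e <= G e) && (G e <= F e))).
  by move=> e; rewrite -eqn_leq.
by apply: Cp_and; apply: Cp_leq.
Qed.

(** Bounded minimisation: the counter sticks at the first [k] with [P k], and ends at [b] if there
    is none below [b]. *)
Definition bmu (b : nat) (P : nat -> bool) : nat :=
  iter b (fun k => if P k then k else k.+1) 0.

Definition bex (b : nat) (P : nat -> bool) : bool := bmu b P < b.

Lemma bmu_none b (P : pred nat) : (forall k, k < b -> ~~ P k) -> bmu b P = b.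
Proof.
elim: b => // b IH nP; rewrite /bmu iterS -/(bmu b P) IH ?(negbTE (nP _ _)) // => k kb.
by apply: nP; apply: ltnW.
Qed.

Lemma bmu_first b (P : pred nat) k : k < b -> P k -> (forall j, j < k -> ~~ P j) -> bmu b P = k.
Proof.
elim: b => // b IH; rewrite ltnS leq_eqVlt /bmu iterS -/(bmu b P).
case: eqP => [<- _|_ /= kb] Pk nP; first by rewrite bmu_none // Pk.
by rewrite IH // Pk.
Qed.

Lemma bexP b (P : pred nat) : reflect (exists2 k, k < b & P k) (bex b P).
Proof.
apply: (iffP idP) => [h|[k kb Pk]].
  apply: contrapT => n; move: h; rewrite /bex bmu_none ?ltnn // => k kb.
  by apply/negP => Pk; apply: n; exists k.
have xP : exists k, P k by exists k.
case: (ex_minnP xP) => m Pm minm.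
have mb : m < b by apply: leq_ltn_trans kb; apply: minm.
rewrite /bex (bmu_first mb Pm) // => j jm; apply/negP => /minm; lia.
Qed.

Lemma Cp_bmu A B (P : env -> pred nat) : Cp A B -> Cp A (fun e => P (fun i => e i.+1) (e 0)) ->
  Cp A (fun e => bmu (B e) (P e)).
Proof.
move=> cB cP; apply: (Cp_iter (B := fun e k => if P e k then k else k.+1)) => //.
  exact: Cp_zero.
by apply: Cp_if => //; [|apply: Cp_succ]; apply: Cp_var.
Qed.

Lemma Cp_bex A B (P : env -> pred nat) : Cp A B -> Cp A (fun e => P (fun i => e i.+1) (e 0)) ->
  Cp A (fun e => bex (B e) (P e)).
Proof. by move=> cB cP; apply: Cp_leq => //; apply: Cp_succ; apply: Cp_bmu. Qed.

Lemma Cp_double A F : Cp A F -> Cp A (fun e => (F e).*2).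
Proof.
by move=> cF; apply: (Cp_ext (F := fun e => F e + F e)) => [e|]; [rewrite addnn|apply: Cp_add].
Qed.

(* On codes of sequences in the sense of [CodeSeq.code], [pr], [hd] and [tl] are
   the list constructor and destructors, with [hd 0 = tl 0 = 0]. *)
Definition pr (x y : nat) : nat := 2 ^ x * y.*2.+1.
Definition hd (z : nat) : nat := bmu z (fun x => bex z (fun y => pr x y == z)).
Definition tl (z : nat) : nat := bmu z (fun y => pr (hd z) y == z).

(** [cp] proves [Cp] goals by following the syntax of the function; [cp_user] is redefined as
    further functions are shown to be computable. *)
Ltac cp_user := fail.
Ltac cp := repeat (cbv beta; first [assumption | lazymatch goal with
  | |- Cp _ (fun _ => ?n) => apply: Cp_const
  | |- Cp _ (fun e => e _) => apply: Cp_var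
  | |- Cp _ (fun e => (@?F e).+1) => apply: (Cp_succ (F := F))
  | |- Cp _ (fun e => (@?F e).-1) => apply: (Cp_pred (F := F))
  | |- Cp _ (fun e => (@?F e).*2) => apply: (Cp_double (F := F))
  | |- Cp _ (fun e => @?F e + @?G e) => apply: (Cp_add (F := F) (G := G))
  | |- Cp _ (fun e => @?F e * @?G e) => apply: (Cp_mul (F := F) (G := G))
  | |- Cp _ (fun e => @?F e ^ @?G e) => apply: (Cp_exp (F := F) (G := G))
  | |- Cp _ (fun e => nat_of_bool (@?F e <= @?G e)) => apply: (Cp_leq (F := F) (G := G))
  | |- Cp _ (fun e => nat_of_bool (~~ @?P e)) => apply: (Cp_neg (P := P))
  | |- Cp _ (fun e => nat_of_bool (@?P e && @?Q e)) => apply: (Cp_and (P := P) (Q := Q))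
  | |- Cp _ (fun e => nat_of_bool (@?P e || @?Q e)) => apply: (Cp_or (P := P) (Q := Q))
  | |- Cp _ (fun e => nat_of_bool (@?F e == @?G e)) => apply: (Cp_eq (F := F) (G := G))
  | |- Cp _ (fun e => nat_of_bool (bex (@?B e) (@?P e))) => apply: (Cp_bex (B := B) (P := P))
  | |- Cp _ (fun e => bmu (@?B e) (@?P e)) => apply: (Cp_bmu (B := B) (P := P))
  | |- Cp _ (fun e => iter (@?K e) (@?B e) (@?I e)) => apply: (Cp_iter (K := K) (B := B) (I := I))
  | |- Cp _ (fun e => ?F (fun i => e (@?r i))) => apply: (Cp_ren r (F := F))
  | |- Cp _ (fun e => if _ then _ else _) => apply: Cp_if
  end | cp_user]).

Lemma Cp_pr A F G : Cp A F -> Cp A G -> Cp A (fun e => pr (F e) (G e)).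
Proof. by move=> cF cG; rewrite /pr; cp. Qed.

Lemma Cp_hd A F : Cp A F -> Cp A (fun e => hd (F e)).
Proof.
move=> cF; apply: (Cp_let (F := fun e => hd (e 0))) => //; rewrite /hd.
by cp; apply: Cp_pr; cp.
Qed.

Lemma Cp_tl A F : Cp A F -> Cp A (fun e => tl (F e)).
Proof.
move=> cF; apply: (Cp_let (F := fun e => tl (e 0))) => //; rewrite /tl.
by cp; apply: Cp_pr; cp; apply: Cp_hd; cp.
Qed.

Ltac cp_user ::= lazymatch goal with
  | |- Cp _ (fun e => pr (@?F e) (@?G e)) => apply: (Cp_pr (F := F) (G := G))
  | |- Cp _ (fun e => hd (@?F e)) => apply: (Cp_hd (F := F))
  | |- Cp _ (fun e => tl (@?F e)) => apply: (Cp_tl (F := F))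
  end.

Arguments CodeSeq.code : simpl never.

Lemma code_cons x s : CodeSeq.code (x :: s) = pr x (CodeSeq.code s).
Proof. by []. Qed.

Lemma pr_code x y : pr x y = CodeSeq.code (x :: CodeSeq.decode y).
Proof. by rewrite code_cons CodeSeq.decodeK. Qed.

Lemma pr_inj x y x' y' : pr x y = pr x' y' -> x = x' /\ y = y'.
Proof.
rewrite !pr_code => /(can_inj CodeSeq.codeK)[-> e]; split=> //.
exact: (can_inj CodeSeq.decodeK).
Qed.

(** Justifies the bounds in [hd] and [tl], which search for the components only below the code. *)
Lemma pr_gt x y : (x < pr x y) && (y < pr x y).
Proof.
rewrite /pr; have x2 : x < 2 ^ x by apply: ltn_expl.
apply/andP; split; nia.
Qed.

Lemma hd_pr x y : hd (pr x y) = x.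
Proof.
have /andP[xz yz] := pr_gt x y.
apply: bmu_first => // [|j jx]; first by apply/bexP; exists y.
by apply/negP => /bexP[k _ /eqP/pr_inj[]]; lia.
Qed.

Lemma tl_pr x y : tl (pr x y) = y.
Proof.
have /andP[xz yz] := pr_gt x y; rewrite /tl hd_pr.
by apply: bmu_first => // j jy; apply/negP => /eqP/pr_inj[_]; lia.
Qed.

Lemma hd_code s : hd (CodeSeq.code s) = head 0 s.
Proof. by case: s => // x s; rewrite code_cons hd_pr. Qed.

Lemma tl_code s : tl (CodeSeq.code s) = CodeSeq.code (behead s).
Proof. by case: s => // x s; rewrite code_cons tl_pr. Qed.

Lemma code_eq0 s : (CodeSeq.code s == 0) = nilp s.
Proof.
case: s => // x s; rewrite code_cons.
by have := pr_gt x (CodeSeq.code s); case: (pr _ _); rewrite ?andbF.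
Qed.

(** Allows a code to serve as the number of rounds of a loop over the list that it codes. *)
Lemma size_code s : size s <= CodeSeq.code s.
Proof.
elim: s => // x s IH; rewrite code_cons.
by have /andP[_] := pr_gt x (CodeSeq.code s); apply: leq_ltn_trans.
Qed.

Definition fld (j i : nat) : nat := hd (iter j tl i).

Lemma fld_nth j i : fld j i = nth 0 (CodeSeq.decode i) j.
Proof.
rewrite -{1}[i]CodeSeq.decodeK /fld; elim: j (CodeSeq.decode i) => [|j IH] s.
  by rewrite hd_code -nth0.
by rewrite iterSr tl_code IH nth_behead.
Qed.

Lemma Cp_fld A j F : Cp A F -> Cp A (fun e => fld j (F e)).
Proof. by move=> cF; apply: Cp_hd; cp; apply: Cp_tl; cp. Qed.

(** * Simulation of Turing machines *)

Ltac cp_user ::= lazymatch goal with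
  | |- Cp _ (fun e => pr (@?F e) (@?G e)) => apply: (Cp_pr (F := F) (G := G))
  | |- Cp _ (fun e => hd (@?F e)) => apply: (Cp_hd (F := F))
  | |- Cp _ (fun e => tl (@?F e)) => apply: (Cp_tl (F := F))
  | |- Cp _ (fun e => fld ?j (@?F e)) => apply: (Cp_fld j (F := F))
  end.

Definition matches (q a o i : nat) : bool := [&& fld 0 i == q, fld 1 i == a & fld 2 i == o].

(** The result codes the instruction list from its first match on, and is 0 if nothing matches. *)
Definition find_instr (e q a o : nat) : nat :=
  iter e (fun r => if (r == 0) || matches q a o (hd r) then r else tl r) e.

Definition mk (q L R o : nat) : nat := pr q (pr L (pr R o)).
Definition cst c := hd c.
Definition cL c := hd (tl c).
Definition cR c := hd (tl (tl c)).
Definition cO c := tl (tl (tl c)).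

Definition shiftS d h := if d == 0 then h.-1 else if d == 1 then h.+1 else h.
Definition newL d w L := if d == 0 then tl L else if d == 1 then pr w L else L.
(** [L == 0] means that the head is on cell 0, where a move left has no effect. *)
Definition newR d w L R :=
  if d == 0 then (if L == 0 then pr w (tl R) else pr (hd L) (pr w (tl R)))
  else if d == 1 then tl R else pr w (tl R).

Definition applyS (i c : nat) : nat :=
  mk (fld 3 i) (newL (fld 5 i) (fld 4 i) (cL c)) (newR (fld 5 i) (fld 4 i) (cL c) (cR c))
    (shiftS (fld 6 i) (cO c)).

(** The oracle tape [O] is an arbitrary function, so that one simulator serves [A], the empty oracle
    and the stage approximations to [A]. *)
Definition findS (O : nat -> nat) (e c : nat) : nat :=
  find_instr e (cst c) (hd (cR c)) (O (cO c)).

Definition stepS O e c := if findS O e c == 0 then c else applyS (hd (findS O e c)) c.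

(** The iterated pair holds the number of 1s seen and the part of the list still unread. *)
Definition ones (z : nat) : nat :=
  hd (iter z (fun p => pr (hd p + (hd (tl p) == 1)) (tl (tl p))) (pr 0 z)).

Definition outS c := ones (cL c) + ones (cR c).

Definition runS O e n t := iter t (stepS O e) (mk 0 0 (iter n (pr 1) 0) 0).

Definition halted O e n t := findS O e (runS O e n t) == 0.
Definition output O e n t := outS (runS O e n t).

Lemma Cp_find_instr A E Q S O : Cp A E -> Cp A Q -> Cp A S -> Cp A O ->
  Cp A (fun e => find_instr (E e) (Q e) (S e) (O e)).
Proof. by move=> cE cQ cS cO; rewrite /find_instr /matches; cp. Qed.

(** The oracle may depend on the environment, as an approximation depends on its stage; variable 0
    is the queried position. *)
Lemma Cp_findS A (O : env -> nat -> nat) E C :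
  Cp A (fun e => O (fun i => e i.+1) (e 0)) -> Cp A E -> Cp A C ->
  Cp A (fun e => findS (O e) (E e) (C e)).
Proof.
move=> cOr cE cC; apply: Cp_find_instr => //; rewrite /cst /cR /cO; cp.
apply: (@Cp_let A (fun e => tl (tl (tl (C e)))) (fun e => O (fun i => e i.+1) (e 0))) => //.
by cp.
Qed.

Lemma Cp_stepS A (O : env -> nat -> nat) E C :
  Cp A (fun e => O (fun i => e i.+1) (e 0)) -> Cp A E -> Cp A C ->
  Cp A (fun e => stepS (O e) (E e) (C e)).
Proof.
move=> cOr cE cC; have cF := Cp_findS cOr cE cC.
by rewrite /stepS /applyS /mk /newL /newR /shiftS /cL /cR /cO; cp.
Qed.

Lemma Cp_runS A (O : env -> nat -> nat) E X T :
  Cp A (fun e => O (fun i => e i.+1) (e 0)) -> Cp A E -> Cp A X -> Cp A T ->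
  Cp A (fun e => runS (O e) (E e) (X e) (T e)).
Proof.
move=> cOr cE cX cT; rewrite /runS /mk.
apply: (Cp_iter (B := fun e => stepS (O e) (E e))) => //; first by cp.
apply: (@Cp_stepS _ (fun e => O (fun i => e i.+1))); last exact: Cp_var.
  (* The current configuration is now a variable, so the environment of [O] shifts by one more while
     its argument stays variable 0. *)
  exact: (Cp_ren (fun i => if i is j.+1 then j.+2 else 0) cOr).
exact: (Cp_ren succn).
Qed.

Lemma Cp_halted A (O : env -> nat -> nat) E X T :
  Cp A (fun e => O (fun i => e i.+1) (e 0)) -> Cp A E -> Cp A X -> Cp A T ->
  Cp A (fun e => halted (O e) (E e) (X e) (T e)).
Proof.
move=> cOr cE cX cT; apply: Cp_eq; last exact: Cp_const.
by apply: (Cp_findS cOr) => //; apply: Cp_runS.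
Qed.

Lemma Cp_output A (O : env -> nat -> nat) E X T :
  Cp A (fun e => O (fun i => e i.+1) (e 0)) -> Cp A E -> Cp A X -> Cp A T ->
  Cp A (fun e => output (O e) (E e) (X e) (T e)).
Proof.
move=> cOr cE cX cT; apply: (Cp_let (F := fun e => outS (e 0))); first exact: Cp_runS.
by rewrite /outS /ones /cL /cR; cp.
Qed.

(** * Correctness of the simulation *)

Lemma iter_fix_id (T : Type) (f : T -> T) x n : f x = x -> iter n f x = x.
Proof. by move=> fx; elim: n => //= n ->. Qed.

Lemma ohead_filter_code (T : Type) (g : nat -> T) (a : pred T) (P : pred nat) s n :
  (forall i, P i = a (g i)) -> size s <= n ->
  let r := iter n (fun r => if (r == 0) || P (hd r) then r else tl r) (CodeSeq.code s) in
  ohead [seq i <- [seq g j | j <- s] | a i] = if r == 0 then None else Some (g (hd r)).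
Proof.
move=> Pa; set f := fun r => _; elim: n s => [|n IH] [|i s] // sn r.
  by rewrite /r iter_fix_id.
have fE : f (CodeSeq.code (i :: s)) = if P i then CodeSeq.code (i :: s) else CodeSeq.code s.
  by rewrite /f code_eq0 hd_code tl_code.
rewrite /r iterSr fE [LHS]/= -Pa; case: ifP => Pi; last exact: IH.
by rewrite iter_fix_id ?code_eq0 ?hd_code // fE Pi.
Qed.

Lemma step_code A e c :
  let r := find_instr e (state c) (nth 0 (tape c) (whead c)) (oracle_cell A (ohd c)) in
  step A (decode_program e) c =
    if r == 0 then None else Some (apply_instr c (decode_instr (hd r))).
Proof.
rewrite /step /decode_program (@ohead_filter_code _ _ _
  (matches (state c) (nth 0 (tape c) (whead c)) (oracle_cell A (ohd c))) _ e).
- by rewrite CodeSeq.decodeK /find_instr; case: ifP.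
- by move=> i; rewrite /matches /applicable /= !fld_nth.
- by rewrite -{2}[e]CodeSeq.decodeK size_code.
Qed.

Definition stepT A M c := odflt c (step A M c).
Definition runT A M n t := iter t (stepT A M) (init n).

Lemma runT_run A M n t c : run A M n t = Some c -> runT A M n t = c.
Proof.
rewrite /run /runT; elim: t c => [|t IH] c /=; first by case.
case rE: (iter t _ _) => [c'|] //= sE; rewrite (IH _ rE) /stepT.
by rewrite sE.
Qed.

(** [stepT] repeats a halted configuration, so the true step count [u] may be less than [t]. *)
Lemma run_runT A M n t : exists u, run A M n u = Some (runT A M n t).
Proof.
elim: t => [|t [u eu]]; first by exists 0.
rewrite /runT iterS -/(runT A M n t) /stepT.
case sE: (step A M (runT A M n t)) => [c|] /=; last by exists u.
by exists u.+1; rewrite /run iterS -/(run A M n u) eu.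
Qed.

(* [z] codes [c], with the tape cut at the head: the part to the left of the
   head is listed backwards, and trailing blanks may be missing or superfluous
   on the right. *)
Definition codes (z : nat) (c : config) : Prop :=
  exists L R, [/\ z = mk (state c) (CodeSeq.code L) (CodeSeq.code R) (ohd c),
    size L = whead c & forall p, nth 0 (tape c) p = nth 0 (rev L ++ R) p].

Lemma mkE q L R o : let c := mk q L R o in (cst c = q) * (cL c = L) * (cR c = R) * (cO c = o).
Proof. by rewrite /cst /cL /cR /cO /mk !(tl_pr, hd_pr). Qed.

Lemma codes_init n : codes (mk 0 0 (iter n (pr 1) 0) 0) (init n).
Proof.
exists [::], (nseq n 1); split=> //=; congr (mk 0 0 _ 0).
by elim: n => // n IH; rewrite iterS IH.
Qed.

Lemma nth_overwrite (L R : seq nat) w p :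
  nth 0 (rev L ++ w :: behead R) p = if p == size L then w else nth 0 (rev L ++ R) p.
Proof.
rewrite !nth_cat size_rev; case: eqP => [->|/eqP ne]; first by rewrite ltnn subnn.
case: ltnP => // le; have -> : p - size L = (p - size L).-1.+1 by lia.
by rewrite /= nth_behead.
Qed.

Lemma codes_findS A e z c : codes z c ->
  findS (oracle_cell A) e z =
  find_instr e (state c) (nth 0 (tape c) (whead c)) (oracle_cell A (ohd c)).
Proof.
move=> [L [R [-> eL et]]]; rewrite /findS !mkE hd_code et -eL nth_cat size_rev ltnn subnn.
by rewrite nth0.
Qed.

Lemma codes_step A e z c : codes z c ->
  codes (stepS (oracle_cell A) e z) (stepT A (decode_program e) c).
Proof.
move=> zc; rewrite /stepS /stepT (codes_findS _ _ zc) step_code.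
set r := find_instr _ _ _ _; case: ifP => // _ /=.
case: zc => [L [R [-> eL et]]]; rewrite /applyS !mkE !fld_nth /=.
set i := CodeSeq.decode (hd r).
have eo : shiftS (nth 0 i 6) (ohd c) = shift (decode_dir (nth 0 i 6)) (ohd c).
  by case: (nth 0 i 6) => [|[|]].
have et' p : nth 0 (set_nth 0 (tape c) (whead c) (nth 0 i 4)) p =
    nth 0 (rev L ++ nth 0 i 4 :: behead R) p.
  by rewrite nth_set_nth /= nth_overwrite eL et.
have -> : apply_instr c (decode_instr (hd r)) =
    Config (nth 0 i 3) (set_nth 0 (tape c) (whead c) (nth 0 i 4))
      (shift (decode_dir (nth 0 i 5)) (whead c)) (shift (decode_dir (nth 0 i 6)) (ohd c)).
  by [].
rewrite eo /newL /newR hd_code !tl_code code_eq0; case: (nth 0 i 5) => [|[|m]] /=.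
- case: L eL et' {et} => [|l L] /= eL et'.
    by exists [::], (nth 0 i 4 :: behead R); split=> //=; rewrite -eL.
  exists L, (l :: nth 0 i 4 :: behead R); split=> [||p] //=; first by rewrite -eL.
  by rewrite et' rev_cons cat_rcons.
- exists (nth 0 i 4 :: L), (behead R); split=> [||p] //=; first by rewrite eL.
  by rewrite et' rev_cons cat_rcons.
- by exists L, (nth 0 i 4 :: behead R).
Qed.

Lemma codes_run A e n t :
  codes (runS (oracle_cell A) e n t) (runT A (decode_program e) n t).
Proof. by elim: t => [|t IH]; [apply: codes_init|apply: codes_step]. Qed.

Lemma ones_code s : ones (CodeSeq.code s) = count_mem 1 s.
Proof.
rewrite /ones -[RHS]add0n; set f := fun p => _.
have fE a u : f (pr a (CodeSeq.code u)) =
    pr (a + (head 0 u == 1)) (CodeSeq.code (behead u)).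
  by rewrite /f hd_pr tl_pr hd_code tl_code.
suff H n a u : size u <= n -> hd (iter n f (pr a (CodeSeq.code u))) = a + count_mem 1 u.
  exact: H (size_code s).
elim: n a u => [|n IH] a u un; first by case: u un; rewrite // hd_pr addn0.
rewrite iterSr fE IH; last by case: u un.
by case: u {un} => [|x u] /=; rewrite ?addn0 // addnA.
Qed.

(** Such lists differ only by trailing blanks, which are not counted. *)
Lemma eq_count_mem1 (s s' : seq nat) : (forall p, nth 0 s p = nth 0 s' p) ->
  count_mem 1 s = count_mem 1 s'.
Proof.
have nil0 (u : seq nat) : (forall p, 0 = nth 0 u p) -> count_mem 1 u = 0.
  by elim: u => //= x u IH u0; have /= <- := u0 0; rewrite IH // => p; apply: (u0 p.+1).
elim: s s' => [|x s IH] s' e; first by rewrite [RHS]nil0 // => p; rewrite -e nth_nil.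
case: s' e => [|y s'] e; first by rewrite [LHS]nil0 // => p; rewrite e nth_nil.
by have /= -> := e 0; rewrite /= (IH s') // => p; apply: (e p.+1).
Qed.

Lemma codes_out z c : codes z c -> outS z = count_mem 1 (tape c).
Proof.
move=> [L [R [-> _ et]]]; rewrite /outS !mkE !ones_code (eq_count_mem1 et).
by rewrite count_cat count_rev.
Qed.

Lemma codes_haltedP A e z c : codes z c ->
  reflect (step A (decode_program e) c = None) (findS (oracle_cell A) e z == 0).
Proof.
move=> zc; rewrite (codes_findS _ _ zc) step_code.
by case: ifP => _; constructor.
Qed.

(** Kleene's normal form: [halted] plays the role of the T predicate and [output] extracts the
    result. *)
Lemma evalP A e n v : eval A (decode_program e) n v <->
  exists2 t, halted (oracle_cell A) e n t & output (oracle_cell A) e n t = v.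
Proof.
split=> [[t [c [/runT_run rc sc ->]]]|[t h <-]].
  exists t; first by apply/(codes_haltedP _ _ (codes_run _ _ _ _)); rewrite rc.
  by rewrite /output (codes_out (codes_run _ _ _ _)) rc.
have [u ru] := run_runT A (decode_program e) n t; exists u, (runT A (decode_program e) n t).
split=> //; first exact/(codes_haltedP _ _ (codes_run _ _ _ _)).
exact: codes_out (codes_run _ _ _ _).
Qed.

(** * Stability in time and oracle use *)

Lemma runS_halted O e n t u : halted O e n t -> t <= u -> runS O e n u = runS O e n t.
Proof.
move=> h /subnK <-; rewrite /runS iterD iter_fix_id // /stepS.
by rewrite -/(runS O e n t); rewrite /halted in h; rewrite h.
Qed.

Lemma halted_mono O e n t u : halted O e n t -> t <= u -> halted O e n u.
Proof. by move=> h tu; rewrite /halted (runS_halted h tu). Qed.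

Lemma output_mono O e n t u : halted O e n t -> t <= u -> output O e n u = output O e n t.
Proof. by move=> h tu; rewrite /output (runS_halted h tu). Qed.

Lemma cO_stepS O e c : cO (stepS O e c) <= (cO c).+1.
Proof.
rewrite /stepS; case: ifP => // _; rewrite /applyS mkE /shiftS.
by case: ifP => _; [|case: ifP => _ //]; rewrite ?leqW // leq_pred.
Qed.

(** The oracle head advances by at most one cell per step, so the number of steps bounds the use. *)
Lemma cO_runS O e n t : cO (runS O e n t) <= t.
Proof.
rewrite /runS; elim: t => [|t IH]; first by rewrite [iter _ _ _]/= mkE.
by rewrite iterS; apply: leq_trans (cO_stepS _ _ _) _.
Qed.

Lemma findS_use O O' e c : O (cO c) = O' (cO c) -> findS O e c = findS O' e c.
Proof. by rewrite /findS => ->. Qed.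

Lemma runSS O e n t : runS O e n t.+1 = stepS O e (runS O e n t).
Proof. by rewrite /runS iterS. Qed.

Lemma runS0 O e n : runS O e n 0 = mk 0 0 (iter n (pr 1) 0) 0.
Proof. by []. Qed.

Lemma runS_use O O' e n t : (forall i, i < t -> O i = O' i) -> runS O e n t = runS O' e n t.
Proof.
elim: t => [|t IH] eO; first by rewrite !runS0.
have {}IH : runS O e n t = runS O' e n t by apply: IH => i /leqW; apply: eO.
rewrite !runSS -IH; move: (eO _ (cO_runS O e n t)); move: (runS O e n t) => c eOc.
by rewrite /stepS (findS_use _ eOc).
Qed.

(** Compared with the run itself, testing for a halt at [t] reads one more cell, possibly cell
    [t]. *)
Lemma halted_use O O' e n t : (forall i, i <= t -> O i = O' i) ->
  halted O e n t = halted O' e n t.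
Proof.
move=> eO; rewrite /halted (runS_use _ _ (O' := O')) => [|i it]; last by apply/eO/ltnW.
by rewrite (findS_use (O' := O')) //; apply/eO/cO_runS.
Qed.

Lemma output_use O O' e n t : (forall i, i <= t -> O i = O' i) ->
  output O e n t = output O' e n t.
Proof. by move=> eO; rewrite /output (runS_use _ _ (O' := O')) // => i it; apply/eO/ltnW. Qed.

(** * The fixed point theorem *)

Lemma eval_fun A M n v w : eval A M n v -> eval A M n w -> v = w.
Proof.
rewrite -(code_programK M) => /evalP[t ht <-] /evalP[u hu <-].
by case: (leqP t u) => [|/ltnW] h; rewrite (output_mono _ h).
Qed.

Lemma computable_eval A M f : (forall n, eval A M n (f n)) -> computable_in A f.
Proof.
by move=> ev; exists M => n v; split=> [[<-] //|/(eval_fun (ev n)) ->].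
Qed.

(** Classical choice turns the single-valued relation [eval] into a partial function. *)
Lemma partial_computable_of M : exists2 psi, partial_computable psi &
  forall n v, eval set0 M n v -> psi n = Some v.
Proof.
pose psi n :=
  if pselect (exists v, eval set0 M n v) is left ex then Some (projT1 (cid ex)) else None.
have psiE n v : eval set0 M n v -> psi n = Some v.
  rewrite /psi; case: pselect => [ex|nex] ev; last by case: nex; exists v.
  by case: cid => w /= /(eval_fun ev) ->.
exists psi => //; exists M => n v; split; last exact: psiE.
by rewrite /psi; case: pselect => // ex [<-]; case: cid.
Qed.

Definition no_oracle (i : nat) : nat := if i == 0 then 0 else 1.

Lemma oracle_cell0 : oracle_cell set0 = no_oracle.
Proof. by apply/funext => -[|n] //=; case: asboolP. Qed.

(* The oracle tape of the stage-[s] approximation to the domain of machine [a]. *)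
Definition approx (a s i : nat) : nat :=
  if i == 0 then 0 else if halted no_oracle a i.-1 s then 2 else 1.

Lemma Cp_no_oracle A F : Cp A F -> Cp A (fun e => no_oracle (F e)).
Proof. by move=> cF; rewrite /no_oracle; cp. Qed.

Lemma Cp_approx A E S F : Cp A E -> Cp A S -> Cp A F ->
  Cp A (fun e => approx (E e) (S e) (F e)).
Proof.
move=> cE cS cF; rewrite /approx; cp.
apply: (Cp_halted (O := fun=> no_oracle)); cp.
by apply: Cp_no_oracle; cp.
Qed.

Lemma Cp_oracle_cell A F : Cp A F -> Cp A (fun e => oracle_cell A (F e)).
Proof.
move=> cF; have cA := Cp_ask (Cp_pred cF).
apply: (@Cp_ext _ (fun e => if F e == 0 then 0 else if `[< A (F e).-1 >] then 2 else 1)).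
  by move=> e; case: (F e).
by cp.
Qed.

Ltac cp_user ::= lazymatch goal with
  | |- Cp _ (fun e => pr (@?F e) (@?G e)) => apply: (Cp_pr (F := F) (G := G))
  | |- Cp _ (fun e => hd (@?F e)) => apply: (Cp_hd (F := F))
  | |- Cp _ (fun e => tl (@?F e)) => apply: (Cp_tl (F := F))
  | |- Cp _ (fun e => no_oracle (@?F e)) => apply: (Cp_no_oracle (F := F))
  | |- Cp _ (fun e => approx (@?E e) (@?S e) (@?F e)) =>
      apply: (Cp_approx (E := E) (S := S) (F := F))
  | |- Cp _ (fun e => oracle_cell _ (@?F e)) => apply: (Cp_oracle_cell (F := F))
  | |- Cp _ (fun e => nat_of_bool (halted (@?O e) (@?E e) (@?X e) (@?T e))) =>
      apply: (Cp_halted (O := O) (E := E) (X := X) (T := T))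
  | |- Cp _ (fun e => output (@?O e) (@?E e) (@?X e) (@?T e)) =>
      apply: (Cp_output (O := O) (E := E) (X := X) (T := T))
  end.

(** Elements once enumerated remain and non-elements never enter, so a correct cell stays
    correct. *)
Lemma approx_mono A a s t i : (forall n, A n <-> exists u, halted no_oracle a n u) ->
  oracle_cell A i = approx a s i -> s <= t -> oracle_cell A i = approx a t i.
Proof.
move=> Aa; case: i => // n; rewrite /approx /= => e st; case: asboolP e => An.
  by case: ifP => // /halted_mono-/(_ _ st) ->.
by case hE: (halted no_oracle a n t) => //; case: An; apply/Aa; exists t.
Qed.

(** Each of the finitely many cells settles at some stage; by monotonicity the largest of these
    stages works for all. *)
Lemma approx_limit A a u : (forall n, A n <-> exists u, halted no_oracle a n u) ->
  exists s, forall i, i <= u -> oracle_cell A i = approx a s i.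
Proof.
move=> Aa; have lim1 i : exists s, oracle_cell A i = approx a s i.
  case: i => [|n]; first by exists 0.
  rewrite /approx /=; case: asboolP => [/Aa[s hs]|nA]; first by exists s; rewrite hs.
  by exists 0; case: ifP => // h; case: nA; apply/Aa; exists 0.
elim: u => [|u [s es]]; first by have [s es] := lim1 0; exists s => i; rewrite leqn0 => /eqP ->.
have [t et] := lim1 u.+1; exists (maxn s t) => i; rewrite leq_eqVlt => /orP[/eqP ->|iu].
  exact: (approx_mono Aa et (leq_maxr _ _)).
exact: (approx_mono Aa (es i iu) (leq_maxl _ _)).
Qed.

Lemma halting_setP x : halting_set x <-> exists t, halted no_oracle x x t.
Proof.
rewrite -oracle_cell0; split=> [[v /evalP[t ht _]]|[t ht]]; first by exists t.
by exists (output (oracle_cell set0) x x t); apply/evalP; exists t.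
Qed.

(* [n] codes a pair of a program and a candidate for the halting set; letting
   the program be part of the input takes the place of the recursion theorem. *)
Lemma diagonal_function a b : exists2 psi, partial_computable psi &
  forall n t, let Q t := halted no_oracle (tl n) (tl n) t && halted no_oracle (hd n) n t in
  Q t -> (forall u, u < t -> ~~ Q u) ->
  psi n = Some (output (approx a t) b (output no_oracle (hd n) n t) t).
Proof.
have [||M ME] := @eval_search set0
  (fun n t => halted no_oracle (tl n) (tl n) t && halted no_oracle (hd n) n t)
  (fun n t => output (approx a t) b (output no_oracle (hd n) n t) t).
- by cp.
- by cp.
have [psi psic psiE] := partial_computable_of M; exists psi => // n t Q Qt ltQ.
exact/psiE/ME.
Qed.

Theorem theorem5p1 (S : Type) (gamma : nat -> S) (A : set nat) (g : nat -> nat) :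
  numbering gamma -> precomplete gamma ->
  computably_enumerable A -> turing_lt A halting_set ->
  computable_in A g ->
  exists n : nat, num_equiv gamma (g n) n.
Proof.
move=> _ pre [psiA [[Ma MaE] AE]] [_ nle] [Mb MbE]; apply: contrapT => nofix.
pose a := code_program Ma; pose b := code_program Mb.
have Aa n : A n <-> exists u, halted no_oracle a n u.
  rewrite AE -oracle_cell0; split=> [[v /MaE]|[u hu]].
    by rewrite -(code_programK Ma) => /evalP[u hu _]; exists u.
  exists (output (oracle_cell set0) a n u); apply/MaE.
  by rewrite -(code_programK Ma); apply/evalP; exists u.
have gb y : exists2 u, halted (oracle_cell A) b y u & output (oracle_cell A) b y u = g y.
  by apply/evalP; rewrite code_programK; apply/MbE.
have [psi psic psiE] := diagonal_function a b.
have [f [[Mf MfE] fE]] := pre _ psic.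
(* [c] computes [f]; on arguments [pr c x] it thus receives its own code as part of the input. *)
pose c := code_program Mf.
have fc n : exists2 t, halted no_oracle c n t & output no_oracle c n t = f n.
  by rewrite -oracle_cell0; apply/evalP; rewrite code_programK; apply/MfE.
have fcE n t : halted no_oracle c n t -> output no_oracle c n t = f n.
  have [u hu <-] := fc n => ht.
  by case: (leqP t u) => [|/ltnW] h; rewrite (output_mono _ h).
apply: nle; pose y x t := output no_oracle c (pr c x) t.
(* Stage [t] can be trusted for [x]: [f (pr c x)] is known, and machine [b] with oracle [A] halts on
   it within some [u <= t] steps, whose possible queries [approx a t] answers correctly. *)
pose Q x t := halted no_oracle c (pr c x) t &&
  bex t.+1 (fun u => halted (oracle_cell A) b (y x t) u &&
    ~~ bex u.+1 (fun i => ~~ (oracle_cell A i == approx a t i))).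
(* With oracle [A], find the first such stage and answer whether [x] has entered the halting set by
   then. *)
have [||M ME] := @eval_search A Q (fun x t => halted no_oracle x x t).
- by rewrite /Q /y; cp.
- by cp.
have QP x t : Q x t <-> halted no_oracle c (pr c x) t /\ exists2 u, u <= t &
    halted (oracle_cell A) b (f (pr c x)) u /\ forall i, i <= u -> oracle_cell A i = approx a t i.
  split=> [/andP[ht /bexP[u ut /andP[hu /bexP ag]]]|[ht [u ut [hu ag]]]].
    split=> //; exists u => //; rewrite -(fcE _ _ ht); split=> // i iu.
    by apply/eqP/negPn/negP => ne; apply: ag; exists i.
  rewrite /Q ht; apply/bexP; exists u => //; rewrite /y (fcE _ _ ht) hu /=.
  by apply/bexP => -[i /ag ->]; rewrite eqxx.
apply: (@computable_eval A M) => x.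
have exQ : exists t, Q x t.
  have [t ht _] := fc (pr c x); have [u hu _] := gb (f (pr c x)); have [s es] := approx_limit u Aa.
  (* By [t] machine [c] halts, by [u] machine [b] halts, and at [s] the cells up to [u] are
     settled. *)
  exists (maxn t (maxn u s)); apply/QP; split; first by apply: halted_mono ht _; lia.
  exists u; first by lia.
  by split=> // i iu; apply: (approx_mono Aa (es i iu)); lia.
case: (ex_minnP exQ) => t Qt mint.
have -> : (if `[< halting_set x >] then 1 else 0) = halted no_oracle x x t; last first.
  by apply: ME => // v vt; apply/negP => /mint; lia.
case: asboolP => [/halting_setP[s hs]|nh]; last first.
  by case hE: halted => //; case: nh; apply/halting_setP; exists t.
case hE: (halted no_oracle x x t) => //; case: nofix.
(* [x] enters the halting set after stage [t]; by then [b] computes [g] on [f (pr c x)]. *)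
have [ht [u ut [hu ag]]] := (QP x t).1 Qt; set n := pr c x in ht hu *.
have exR : exists w, halted no_oracle (tl n) (tl n) w && halted no_oracle (hd n) n w.
  exists (maxn s t); rewrite /n tl_pr hd_pr.
  by rewrite (halted_mono hs (leq_maxl _ _)) (halted_mono ht (leq_maxr _ _)).
(* [w] is the stage used by [psi n]: the first at which [x] is in the halting set and [c] has halted
   on [n]. *)
case: (ex_minnP exR) => w Rw minw.
have fn := fE n _ (psiE n w Rw _); have {Rw}/andP[] := Rw.
rewrite /n tl_pr hd_pr -/n => hxw hw.
(* At stage [t] the number [x] had not yet entered, so [w] is later. *)
have tw : t <= w by apply: ltnW; rewrite ltnNge; apply/negP => /(halted_mono hxw); rewrite hE.
(* The fixed point is [f n]: it is equivalent to the value of [psi] at [n], which turns out to be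
   [g (f n)]. *)
exists (f n); rewrite /num_equiv fn {fn}; last first.
  by move=> v vw; apply: contraTN vw => /minw; rewrite -leqNgt.
rewrite /n hd_pr -/n.
have ag' i : i <= u -> oracle_cell A i = approx a w i.
  by move=> iu; apply: approx_mono (ag i iu) tw.
(* As [u <= t <= w] and the oracles agree up to [u], the run with [approx a w] has halted by stage
   [w], with the same output as the run with oracle [A]. *)
rewrite (fcE _ _ hw) (output_mono (t := u)) -?(halted_use _ _ ag') //; last exact: leq_trans tw.
rewrite -(output_use _ _ ag'); have [v hv <-] := gb (f n).
by case: (leqP u v) => [|/ltnW] h; rewrite (output_mono _ h).
Qed.
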